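(* Let $G$ be a finite, simple, undirected graph with $n \geq 1$ vertices and $m$ edges, let $\lambda(G)$ denote the largest eigenvalue of the adjacency matrix of $G$, and let $s(G)=\sum_{u\in V(G)}\left|d_G(u)-\frac{2m}{n}\right|$, where $d_G(u)$ is the degree of $u$ in $G$. Then $$\lambda(G)-\frac{2m}{n}\leq \sqrt{\frac{2s(G)}{3}}.$$
   Context: $s(G)$ is called the degree deviation of $G$; $\lambda(G)$ is the spectral radius of $G$. *)

(* Defs.v *)
From mathcomp Require Import all_boot all_order all_algebra.
From mathcomp Require Import classical_sets reals.
From mathcomp Require complex.
Set Implicit Arguments.
Unset Strict Implicit.
Unset Printing Implicit Defensive.
Import Order.TTheory GRing.Theory Num.Theory.
Local Open Scope ring_scope.

Record sgraph := SGraph {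
  vertex :> finType;
  adj : rel vertex;
  adj_sym : symmetric adj;
  adj_irr : irreflexive adj }.

Section Definitions.
Variables (R : realType) (G : sgraph).

Definition deg (u : G) : nat := #|[set v | adj u v]|.

Definition edges : {set {set G}} :=
  [set [set p.1; p.2] | p : G * G & adj p.1 p.2].

(* Rows and columns are indexed along the enumeration of the vertices. *)
Definition adjmx : 'M[R]_#|G| :=
  \matrix_(i, j) (adj (enum_val i) (enum_val j))%:R.

(* This supremum is a maximum as soon as G has a vertex: see lambdaP. *)
Definition lambda : R := sup [set x : R | eigenvalue adjmx x].

Definition avg_deg : R := 2 * #|edges|%:R / #|G|%:R.

Definition degree_deviation : R := \sum_(u : G) `|(deg u)%:R - avg_deg|.

End Definitions.

Section LargestEigenvalue.
Import complex sesquilinear spectral.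
Local Open Scope sesquilinear_scope.
Variable R : realType.

Lemma sym_eigenvalue_real n (A : 'M[R]_n) (z : R[i]) : A^T = A ->
  eigenvalue (map_mx (real_complex R) A) z -> z \is Num.real.
Proof.
move=> symA /eigenvalueP [v vA v0].
set B := map_mx _ A in vA.
have BE : B^t* = B.
  apply/matrixP => i j; rewrite !mxE -[in LHS]symA mxE.
  exact: conjc_real.
have q0 : (v *m v^t*) 0 0 != 0.
  by rewrite -dotmxE dnorm_eq0.
have vBt : B *m v^t* = z^* *: v^t*.
  by rewrite -{1}BE -map_mxM -trmx_mul vA linearZ /= map_mxZ.
rewrite CrealE; apply/eqP; apply: (mulIf q0).
have : (v *m B *m v^t*) 0 0 = z * (v *m v^t*) 0 0.
  by rewrite vA -scalemxAl mxE.
by rewrite -mulmxA vBt -scalemxAr mxE.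
Qed.

Lemma sym_eigenvalue_max n (A : 'M[R]_n) : (0 < n)%N -> A^T = A ->
  exists2 x, eigenvalue A x & forall y, eigenvalue A y -> y <= x.
Proof.
move=> n0 symA; set B := map_mx (real_complex R) A.
have AB x : eigenvalue A x = eigenvalue B x%:C%C.
  by rewrite !eigenvalue_root_char -map_char_poly fmorph_root.
have [r Br] := closed_field_poly_normal (char_poly B).
have c0 : lead_coef (char_poly B) != 0.
  by rewrite lead_coef_eq0 monic_neq0 ?char_poly_monic.
have Er z : eigenvalue B z = (z \in r).
  by rewrite eigenvalue_root_char Br rootZ // root_prod_XsubC.
have [z0 Bz0] := eigenvalue_closed B n0.
pose s := [seq complex.Re z | z <- r].
have As x : eigenvalue A x = (x \in s).
  apply/idP/mapP => [|[z]].
    by rewrite AB Er => xr; exists x%:C%C.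
  rewrite -Er => Bz ->; rewrite AB RRe_real //.
  exact: sym_eigenvalue_real Bz.
have : complex.Re z0 \in s by apply: map_f; rewrite -Er.
suff [s0|[x xs xmax]] : s = [::] \/
    exists2 x, x \in s & forall y, y \in s -> y <= x.
  by rewrite s0.
  by exists x; rewrite ?As // => y; rewrite As; apply: xmax.
elim: (s) => [|a t [->|[x xt xmax]]]; first by left.
  by right; exists a; rewrite ?mem_head // => y; rewrite inE => /eqP ->.
right; exists (Num.max a x).
  by rewrite /Num.max; case: ifP; rewrite inE ?xt ?eqxx ?orbT.
move=> y; rewrite inE le_max => /orP[/eqP ->|/xmax ->].
  by rewrite lexx.
by rewrite orbT.
Qed.

Lemma lambdaP (G : sgraph) : (0 < #|G|)%N ->
  eigenvalue (adjmx R G) (lambda R G) /\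
  forall x, eigenvalue (adjmx R G) x -> x <= lambda R G.
Proof.
move=> n0.
have symA : (adjmx R G)^T = adjmx R G.
  by apply/matrixP => i j; rewrite !mxE adj_sym.
have [x Ax xmax] := sym_eigenvalue_max n0 symA.
suff -> : lambda R G = x by [].
apply/eqP; rewrite eq_le; apply/andP; split.
  by apply: ge_sup => //; exists x.
by apply: ub_le_sup => //; exists x.
Qed.

End LargestEigenvalue.

(* Main.v *)
Require Import Defs.
From mathcomp Require Import all_boot all_order all_algebra reals.
From mathcomp Require Import ring lra.
Import Order.TTheory GRing.Theory Num.Theory.
Local Open Scope ring_scope.

(** Write [d] for the average degree and [S] for the sum of the positive parts
    of [deg v - d]; since the deviations sum to [0], [S] is half the degree
    deviation.  The row sum of [A^2 - (d - 1) A] at [u] equals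
    [d + \sum_v (deg v - d)], where [v] runs over the closed neighbourhood of
    [u], so it is at most [d + S].  Weighting the rows by a nonnegative
    eigenvector for [lambda] yields [lambda^2 - (d - 1) lambda <= d + S], that
    is, [(lambda - d) (lambda + 1) <= S], which even gives
    [(lambda - d)^2 <= S]. *)

(* A nonnegative [w] with [lam w <= w A] is enough, so the entrywise absolute
   value of any eigenvector will do and no Perron-Frobenius theorem is needed. *)
Lemma subeigenvector_row_bound (R : realDomainType) (T : finType)
    (a : T -> T -> R) (w : T -> R) (lam c M : R) :
  (forall u v, 0 <= a u v) -> (forall u, 0 <= w u) -> 0 < \sum_u w u ->
  0 <= lam + c ->
  (forall v, lam * w v <= \sum_u w u * a u v) ->
  (forall u, \sum_v a u v * (\sum_t a v t + c) <= M) ->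
  lam * (lam + c) <= M.
Proof.
move=> a0 w0 W0 lc0 sub rowM.
pose r v := \sum_t a v t; pose y v := \sum_u w u * a u v - lam * w v.
have y0 v : 0 <= y v by rewrite subr_ge0.
have r0 v : 0 <= r v by apply: sumr_ge0.
have wr : \sum_v w v * r v = lam * (\sum_v w v) + \sum_v y v.
  rewrite sumrB -mulr_sumr addrC subrK exchange_big /=.
  by apply: eq_bigr => u _; rewrite mulr_sumr.
rewrite -(ler_pM2r W0) [leRHS]mulr_sumr.
apply: le_trans (_ : \sum_u w u * \sum_v a u v * (r v + c) <= _); last first.
  by apply: ler_sum => u _; rewrite mulrC ler_wpM2r.
(* Here [\sum_u w u * a u v] is [lam * w v + y v]. By [wr] the total is then
   [lam * (lam + c) * \sum_v w v] plus two nonnegative terms in the defect [y]. *)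
have -> : \sum_u w u * (\sum_v a u v * (r v + c)) =
    \sum_v (lam * (w v * r v) + lam * c * w v + y v * r v + c * y v).
  under eq_bigr do rewrite mulr_sumr.
  rewrite exchange_big; apply: eq_bigr => v _ /=.
  under eq_bigr do rewrite mulrA.
  by rewrite -mulr_suml /y; ring.
rewrite !big_split /= -!mulr_sumr wr.
have yr0 : 0 <= \sum_v y v * r v by apply: sumr_ge0 => v _; apply: mulr_ge0.
have cY0 : 0 <= (lam + c) * \sum_v y v by apply: mulr_ge0 => //; apply: sumr_ge0.
lra.
Qed.

Lemma card_edge_orientations (G : sgraph) (e : {set G}) : e \in edges G ->
  #|[set p : G * G | adj p.1 p.2 & [set p.1; p.2] == e]| = 2%N.
Proof.
case/imsetP => -[x y]; rewrite inE /= => xy ->.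
have xNy : x != y by apply: contraTneq xy => ->; rewrite adj_irr.
have -> : [set p : G * G | adj p.1 p.2 & [set p.1; p.2] == [set x; y]] =
    [set (x, y); (y, x)].
  apply/setP => -[u v]; rewrite !inE /= !xpair_eqE.
  apply/andP/orP => [[uv /eqP E]|[] /andP[/eqP-> /eqP->]]; first last.
  - by rewrite adj_sym xy setUC.
  - by rewrite xy.
  have uNv : u != v by apply: contraTneq uv => ->; rewrite adj_irr.
  have : u \in [set x; y] by rewrite -E set21.
  have : v \in [set x; y] by rewrite -E set22.
  rewrite !inE => /orP[] /eqP Ev /orP[] /eqP Eu; subst u v.
  - by rewrite eqxx in uNv.
  - by right; rewrite !eqxx.
  - by left; rewrite !eqxx.
  - by rewrite eqxx in uNv.
by rewrite cards2 xpair_eqE negb_and xNy.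
Qed.

(** Ordered adjacent pairs are counted in two ways: by first vertex, and by underlying edge, each
    edge having two orientations. *)
Lemma handshake (G : sgraph) : (\sum_(u : G) deg u = 2 * #|edges G|)%N.
Proof.
transitivity #|[set p : G * G | adj p.1 p.2]|.
  rewrite -sum1_card (eq_bigl (fun p : G * G => xpredT p.1 && adj p.1 p.2)).
    rewrite -(pair_big_dep xpredT (fun u v : G => adj u v) (fun _ _ => 1%N)) /=.
    by apply: eq_bigr => u _; rewrite /deg -sum1_card; apply: eq_bigl => v; rewrite inE.
  by move=> p; rewrite inE.
rewrite -sum1_card
  (partition_big (fun p : G * G => [set p.1; p.2]) (fun e => e \in edges G)) /=.
  rewrite mulnC -sum_nat_const; apply: eq_bigr => e eG.
  rewrite -(card_edge_orientations _ _ eG) -sum1_card.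
  by apply: eq_bigl => p; rewrite !inE.
by move=> p pG; apply: imset_f; move: pG; rewrite !inE.
Qed.

Section DegreeDeviation.
Variables (R : realType) (G : sgraph).
Hypothesis G_gt0 : (0 < #|G|)%N.

Let d : R := avg_deg R G.

Lemma sum_deviation : \sum_(u : G) ((deg u)%:R - d) = 0.
Proof.
have n0 : #|G|%:R != 0 :> R by rewrite pnatr_eq0 -lt0n.
rewrite sumrB sumr_const -natr_sum handshake /d /avg_deg -[X in _ - X]mulr_natr.
by rewrite divfK // natrM subrr.
Qed.

Lemma sum_deviation_le (P : pred G) :
  \sum_(u | P u) ((deg u)%:R - d) <= degree_deviation R G / 2.
Proof.
(* Each summand is the positive part of a deviation; the second halves sum to zero. *)
have -> : degree_deviation R G / 2 =
    \sum_(u : G) (`|(deg u)%:R - d| / 2 + ((deg u)%:R - d) / 2).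
  by rewrite big_split /= -!mulr_suml sum_deviation mul0r addr0.
rewrite big_mkcond; apply: ler_sum => u _.
by case: ifP => _; have := ler_norm ((deg u)%:R - d);
  have := ler_norm (- ((deg u)%:R - d)); rewrite normrN; lra.
Qed.

Lemma sum_adj (u : G) : \sum_v (adj u v)%:R = (deg u)%:R :> R.
Proof.
rewrite -natr_sum /deg -sum1_card [in RHS]big_mkcond; congr _%:R.
by apply: eq_bigr => v _; rewrite inE; case: adj.
Qed.

Lemma lambda_bound : d <= lambda R G ->
  (lambda R G - d) * (lambda R G + 1) <= degree_deviation R G / 2.
Proof.
set lam := lambda R G => dlam.
have d0 : 0 <= d by rewrite divr_ge0 // -natrM.
have [/eigenvalueP[x xA x0] _] := @lambdaP R G G_gt0.
pose w u := `|x 0 (enum_rank u)|.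
have w0 u : 0 <= w u := normr_ge0 _.
(* Expanding, [(lam - d) * (lam + 1)] is [lam * (lam + (1 - d)) - d], hence the shift
   [c = 1 - d]. *)
suff : lam * (lam + (1 - d)) <= degree_deviation R G / 2 + d by lra.
apply: (@subeigenvector_row_bound R G (fun u v => (adj u v)%:R) w) => //.
- have /rV0Pn[i xi] := x0.
  rewrite (bigD1 (enum_val i)) //= ltr_wpDr ?sumr_ge0 //.
  by rewrite /w enum_valK normr_gt0.
- lra.
(* Triangle inequality in the eigenvector equation; [lam] is its own absolute value since
   [0 <= d <= lam]. *)
- move=> v; rewrite /w -[lam]ger0_norm; last by rewrite (le_trans d0).
  rewrite -normrM.
  have <- : (x *m adjmx R G) 0 (enum_rank v) = lam * x 0 (enum_rank v).
    by rewrite xA mxE.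
  rewrite mxE (reindex _ (onW_bij _ (@enum_rank_bij G))) /=.
  apply: le_trans (ler_norm_sum _ _ _) _; apply: ler_sum => u _.
  by rewrite mxE !enum_rankK normrM normr_nat.
move=> u.
(* The [1] in [1 - d] adds [deg u] to the row sum, which is [d] plus the deviation of [u] itself;
   this closes the neighbourhood. *)
have := sum_deviation_le (fun v => (v == u) || adj u v).
rewrite (bigD1 u) ?eqxx //=.
rewrite (eq_bigl (fun v => adj u v)); last first.
  by move=> v; case: eqP => [->|_]; rewrite ?adj_irr ?andbT.
have -> : \sum_v (adj u v)%:R * (\sum_t (adj v t)%:R + (1 - d)) =
    \sum_(v | adj u v) ((deg v)%:R - d) + (deg u)%:R.
  rewrite -sum_adj [in RHS]big_mkcond -big_split /=; apply: eq_bigr => v _.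
  by rewrite sum_adj; case: adj => /=; ring.
lra.
Qed.

End DegreeDeviation.

Theorem theorem1 (R : realType) (G : sgraph) (n_ge1 : (1 <= #|G|)%N) :
  lambda R G - 2 * #|edges G|%:R / #|G|%:R
    <= Num.sqrt (2 * degree_deviation R G / 3).
Proof.
rewrite -/(avg_deg R G).
have [dlam|/ltW lamd] := leP (avg_deg R G) (lambda R G); last first.
  by rewrite (le_trans _ (sqrtr_ge0 _)) // subr_le0.
have d0 : 0 <= avg_deg R G by rewrite divr_ge0 // -natrM.
have s0 : 0 <= degree_deviation R G by apply: sumr_ge0.
have t0 : 0 <= lambda R G - avg_deg R G by rewrite subr_ge0.
rewrite -(ger0_norm t0) -sqrtr_sqr; apply: ler_wsqrtr.
have := lambda_bound _ _ n_ge1 dlam.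
(* Splitting [lambda + 1] as [(lambda - d) + (d + 1)] and dropping this product leaves
   [(lambda - d)^2 <= s / 2 <= 2 * s / 3], with [s] the degree deviation. *)
have : 0 <= (lambda R G - avg_deg R G) * (avg_deg R G + 1).
  by apply: mulr_ge0 => //; apply: addr_ge0.
rewrite expr2; lra.
Qed.
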